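(* Let $(\mathcal{J},\bullet)$ be a mock-Lie superalgebra and $(\mathcal{V},\pi)$ a representation of $\mathcal{J}$. Consider the even linear map $\pi^*:\mathcal{J}\to\mathrm{End}(\mathcal{V}^* )$ defined by $$\pi^*(x)(f)=(-1)^{|f||x|}f\circ\pi(x),\qquad x\in\mathcal{J}_{|x|},\ f\in\mathcal{V}^*_{|f|}.$$ Then $(\mathcal{V}^*,\pi^* )$ is a representation of $\mathcal{J}$.
   Context: All vector spaces are finite-dimensional over a field $\mathbb{K}$ of characteristic $0$; $|x|$ denotes the degree of a homogeneous element $x$ of a $\mathbb{Z}_2$-graded space. A mock-Lie superalgebra is a $\mathbb{Z}_2$-graded vector space $\mathcal{J}=\mathcal{J}_{\bar 0}\oplus\mathcal{J}_{\bar 1}$ with an even bilinear product $\bullet$ (i.e. $\mathcal{J}_i\bullet\mathcal{J}_j\subset\mathcal{J}_{i+j}$) such that for all homogeneous $x,y,z$: $x\bullet y=(-1)^{|x||y|}y\bullet x$, and $(-1)^{|x||z|}x\bullet(y\bullet z)+(-1)^{|x||y|}y\bullet(z\bullet x)+(-1)^{|y||z|}z\bullet(x\bullet y)=0$. A representation of $\mathcal{J}$ is a pair $(\mathcal{V},\pi)$ with $\mathcal{V}$ a $\mathbb{Z}_2$-graded vector space and $\pi:\mathcal{J}\to\mathrm{End}(\mathcal{V})$ an even linear map (for the natural grading of $\mathrm{End}(\mathcal V)$) such that for all homogeneous $x,y\in\mathcal{J}$: $\pi(x\bullet y)=-\pi(x)\pi(y)-(-1)^{|x||y|}\pi(y)\pi(x)$.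 $\mathcal{V}^*$ is the dual space with its natural $\mathbb{Z}_2$-grading ($f\in\mathcal{V}^*_{i}$ iff $f$ vanishes on $\mathcal{V}_{i+\bar 1}$). *)

(* Defs.v *)
From HB Require Import structures.
From mathcomp Require Import all_boot all_order all_algebra.

Set Implicit Arguments.
Unset Strict Implicit.
Unset Printing Implicit Defensive.

Import GRing.Theory.
Local Open Scope ring_scope.

(* Degrees live in 'Z_2, whose elements are ordinals: in a sign exponent such
   as (i * j)%N they are read as natural numbers in {0, 1}.  The vector 0 lies
   in both components, so conditions on homogeneous vectors range over vectors
   together with a degree of a component containing them. *)

Definition supergrading (K : fieldType) (V : vectType K)
    (V_ : 'Z_2 -> {vspace V}) : Prop :=
  directv (V_ 0%R + V_ 1%R) /\ (V_ 0%R + V_ 1%R)%VS = fullv.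

Record mock_lie_superalgebra (K : fieldType) (J : vectType K)
    (J_ : 'Z_2 -> {vspace J}) (m : {bilinear J -> J -> J}) : Prop := {
  mls_grading : supergrading J_;
  mls_even : forall (i j : 'Z_2) (x y : J),
    x \in J_ i -> y \in J_ j -> m x y \in J_ (i + j);
  mls_supercomm : forall (i j : 'Z_2) (x y : J),
    x \in J_ i -> y \in J_ j -> m x y = (-1) ^+ (i * j)%N *: m y x;
  mls_jacobi : forall (i j k : 'Z_2) (x y z : J),
    x \in J_ i -> y \in J_ j -> z \in J_ k ->
    (-1) ^+ (i * k)%N *: m x (m y z) + (-1) ^+ (i * j)%N *: m y (m z x)
      + (-1) ^+ (j * k)%N *: m z (m x y) = 0
}.

Definition end_homogeneous (K : fieldType) (V : vectType K)
    (V_ : 'Z_2 -> {vspace V}) (i : 'Z_2) (f : 'End(V)) : Prop :=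
  forall (j : 'Z_2) (v : V), v \in V_ j -> f v \in V_ (i + j).

(* In a vectType, 'End(V) has no ring structure when V is trivial, so the
   product of endomorphisms is the composition of linear functions. *)
Record mls_representation (K : fieldType) (J : vectType K)
    (J_ : 'Z_2 -> {vspace J}) (m : {bilinear J -> J -> J})
    (V : vectType K) (V_ : 'Z_2 -> {vspace V}) (pi : 'Hom(J, 'End(V))) : Prop := {
  rep_grading : supergrading V_;
  rep_even : forall (i : 'Z_2) (x : J), x \in J_ i -> end_homogeneous V_ i (pi x);
  rep_mul : forall (i j : 'Z_2) (x y : J), x \in J_ i -> y \in J_ j ->
    pi (m x y) = - (pi x \o pi y)%VF - (-1) ^+ (i * j)%N *: (pi y \o pi x)%VF
}.

Section PreComposition.
Variables (K : fieldType) (U V W : vectType K) (g : 'Hom(U, V)).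

Definition precomp_lfun (f : 'Hom(V, W)) : 'Hom(U, W) := (f \o g)%VF.

Lemma precomp_lfun_is_linear : linear precomp_lfun.
Proof. by move=> a f h; apply/lfunP=> u; rewrite !lfun_simp. Qed.

HB.instance Definition _ := GRing.isLinear.Build K 'Hom(V, W) 'Hom(U, W) *:%R
  precomp_lfun precomp_lfun_is_linear.

End PreComposition.

(* The forms vanishing on V_ (i + 1), as a subspace of the dual: see
   memv_dual_homog. *)
Definition dual_homog (K : fieldType) (V : vectType K)
    (V_ : 'Z_2 -> {vspace V}) (i : 'Z_2) : {vspace 'Hom(V, K^o)} :=
  lker (linfun (precomp_lfun (projv (V_ (i + 1))))).

Lemma memv_dual_homog (K : fieldType) (V : vectType K)
    (V_ : 'Z_2 -> {vspace V}) (i : 'Z_2) (f : 'Hom(V, K^o)) :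
  f \in dual_homog V_ i <-> forall v : V, v \in V_ (i + 1) -> f v = 0.
Proof.
rewrite memv_ker lfunE /= /precomp_lfun; split=> [/eqP f0 v Vv | f0].
  by rewrite -(projv_id Vv) -comp_lfunE f0 lfunE.
by apply/eqP/lfunP=> v; rewrite !lfunE /= f0 ?memv_proj.
Qed.

(* A linear map is determined by its values on homogeneous vectors, so this
   formula characterizes pi^* . *)
Definition is_dual_map (K : fieldType) (J : vectType K)
    (J_ : 'Z_2 -> {vspace J}) (V : vectType K) (V_ : 'Z_2 -> {vspace V})
    (pi : 'Hom(J, 'End(V))) (pi' : 'Hom(J, 'End('Hom(V, K^o)))) : Prop :=
  forall (i j : 'Z_2) (x : J) (f : 'Hom(V, K^o)),
    x \in J_ i -> f \in dual_homog V_ j ->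
    pi' x f = (-1) ^+ (j * i)%N *: (f \o pi x)%VF.

(* Main.v *)
(** On homogeneous vectors, [pi^*(x) (pi^*(y) f)] is [f \o pi y \o pi x] up to
    a sign: composition on the right reverses the order of the two factors, and
    since [f \o pi y] has degree [|f| + |y|], the sign picks up an additional
    [(-1)^(|x||y|)] which exactly swaps the two terms of the representation
    identity.  The map itself is obtained by summing its prescribed values over
    homogeneous components; everything else is extended from homogeneous
    vectors by linearity. *)

Require Import Defs.
From HB Require Import structures.
From mathcomp Require Import all_boot all_order all_algebra.

Set Implicit Arguments.
Unset Strict Implicit.
Unset Printing Implicit Defensive.

Import GRing.Theory.
Local Open Scope ring_scope.

Lemma Z2_neq (i j : 'Z_2) : i != j -> i = j + 1.
Proof.
by case: i j => [[|[|//]] ilt] [[|[|//]] jlt] // _; apply: val_inj.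
Qed.

Lemma Z2_addKK (i : 'Z_2) : i + 1 + 1 = i.
Proof. by case: i => [[|[|//]] ilt]; apply: val_inj. Qed.

Lemma Z2_addr1_neq (i : 'Z_2) : i + 1 != i.
Proof. by case: i => [[|[|//]] ilt]. Qed.

Lemma sum_Z2 (G : nmodType) (i : 'Z_2) (F : 'Z_2 -> G) :
  \sum_j F j = F i + F (i + 1).
Proof.
rewrite (bigD1 i) // (bigD1 (i + 1)) ?Z2_addr1_neq //=.
rewrite [X in _ + (_ + X)]big1 ?addr0 // => j /andP[/Z2_neq ->].
by rewrite eqxx.
Qed.

Section Supergrading.
Variables (K : fieldType) (W : vectType K) (W_ : 'Z_2 -> {vspace W}).
Hypothesis sW : supergrading W_.

(** The projection along the other component; [projv (W_ i)] would project along some complement not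
    tied to the grading. *)
Definition homog_proj (i : 'Z_2) : 'End(W) := daddv_pi (W_ i) (W_ (i + 1)).

Lemma supergrading_cap i : (W_ i :&: W_ (i + 1)%R = 0)%VS.
Proof.
have [/directv_addP cap0 _] := sW.
have [->|/Z2_neq ->] := eqVneq i 0; first by rewrite add0r.
by rewrite Z2_addKK add0r capvC.
Qed.

Lemma supergrading_full i : (W_ i + W_ (i + 1)%R = fullv)%VS.
Proof.
have [_ full] := sW.
have [->|/Z2_neq ->] := eqVneq i 0; first by rewrite add0r.
by rewrite Z2_addKK add0r addvC.
Qed.

Lemma memv_homog_proj i w : homog_proj i w \in W_ i.
Proof. exact: memv_pi. Qed.

Lemma homog_proj_id i w : w \in W_ i -> homog_proj i w = w.
Proof. exact/daddv_pi_id/supergrading_cap. Qed.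

Lemma homog_proj_sum w : \sum_i homog_proj i w = w.
Proof.
rewrite (sum_Z2 0) -[RHS](daddv_pi_add (supergrading_cap 0)).
  by rewrite /homog_proj Z2_addKK.
by rewrite supergrading_full memvf.
Qed.

(** The decomposition of [w] reads [w = w + homog_proj (i + 1) w], and [w] cancels. *)
Lemma homog_proj_neq i j w : w \in W_ i -> j != i -> homog_proj j w = 0.
Proof.
move=> Ww /Z2_neq ->; have := homog_proj_sum w.
rewrite (sum_Z2 i) homog_proj_id // => /(canRL (addKr w)).
by rewrite addNr.
Qed.

Lemma homog_lfunP (U : vectType K) (g h : 'Hom(W, U)) :
  (forall i w, w \in W_ i -> g w = h w) -> g = h.
Proof.
move=> gh; apply/lfunP=> w; rewrite -(homog_proj_sum w) !linear_sum.
by apply: eq_bigr => i _; apply/gh/memv_homog_proj.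
Qed.

(** A form of degree [i] kills [W_ (i + 1)], so it sees only the degree [i] part of a vector.
    Precomposition with [homog_proj j] is thus the projection of the dual onto degree [j]. *)
Lemma dual_homog_comp_proj i j (f : 'Hom(W, K^o)) :
  f \in dual_homog W_ i ->
  (f \o homog_proj j)%VF = if j == i then f else 0.
Proof.
move/memv_dual_homog => f0.
have fproj k w : k != i -> f (homog_proj k w) = 0.
  by move/Z2_neq=> ->; apply/f0/memv_homog_proj.
case: eqVneq => [-> | ji]; apply/lfunP=> w; rewrite comp_lfunE; last first.
  by rewrite fproj ?zero_lfunE.
rewrite -[in RHS](homog_proj_sum w) linear_sum (bigD1 i) //=.
by rewrite [X in _ + X]big1 ?addr0 // => k /fproj.
Qed.

(** A form in both components vanishes on [W_ 0] and [W_ 1], hence everywhere; and any [f] is the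
    sum of its composites with the two homogeneous projections. *)
Lemma dual_supergrading : supergrading (dual_homog W_).
Proof.
split.
  apply/directv_addP/eqP; rewrite -subv0; apply/subvP=> f.
  rewrite memv_cap memv0 => /andP[/memv_dual_homog f1 /memv_dual_homog f0].
  apply/eqP/homog_lfunP => i w Ww; rewrite zero_lfunE.
  have [i1 | /Z2_neq i1] := eqVneq i 1.
    by apply: f1; rewrite add0r -i1.
  by apply: f0; rewrite -i1.
apply/eqP; rewrite eqEsubv subvf /=; apply/subvP=> f _.
have mem i : (f \o homog_proj i)%VF \in dual_homog W_ i.
  apply/memv_dual_homog=> w Ww; rewrite comp_lfunE.
  by rewrite (homog_proj_neq Ww) ?linear0 // eq_sym Z2_addr1_neq.
suff -> : f = (f \o homog_proj 0)%VF + (f \o homog_proj 1)%VF.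
  by rewrite memv_add.
apply/lfunP=> w; rewrite add_lfunE !comp_lfunE -[in LHS](homog_proj_sum w).
by rewrite linear_sum (sum_Z2 0) add0r.
Qed.

End Supergrading.

Section DualMap.
Variables (K : fieldType) (J V : vectType K).
Variables (J_ : 'Z_2 -> {vspace J}) (V_ : 'Z_2 -> {vspace V}).
Variable pi : 'Hom(J, 'End(V)).

(** The sign in [pi^*] depends on the degree [j] of the form. Since such a form sees only [V_ j],
    the sign can be carried by the degree [j] part of the values of [pi x], so that [pi^*(x)]
    becomes precomposition with one endomorphism of [V]. *)
Definition twisted_action (x : J) : 'End(V) :=
  \sum_(i : 'Z_2) \sum_(j : 'Z_2)
    (-1) ^+ (j * i)%N *: (homog_proj V_ j \o pi (homog_proj J_ i x))%VF.

Definition dual_map_fun (x : J) : 'End('Hom(V, K^o)) :=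
  linfun (precomp_lfun (twisted_action x)).

Lemma dual_map_funE x f : dual_map_fun x f = (f \o twisted_action x)%VF.
Proof. by rewrite lfunE. Qed.

Lemma twisted_action_is_linear : linear twisted_action.
Proof.
move=> a x y; rewrite /twisted_action scaler_sumr -big_split /=.
apply: eq_bigr => i _; rewrite scaler_sumr -big_split /=.
apply: eq_bigr => j _; rewrite !linearP /= comp_lfunDr -comp_lfunZr.
by rewrite scalerDr !scalerA mulrC.
Qed.

Lemma dual_map_fun_is_linear : linear dual_map_fun.
Proof.
move=> a x y; apply/lfunP=> f; rewrite add_lfunE scale_lfunE !dual_map_funE.
by rewrite twisted_action_is_linear comp_lfunDr -comp_lfunZr.
Qed.

HB.instance Definition _ := GRing.isLinear.Build K J 'End('Hom(V, K^o)) *:%R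
  dual_map_fun dual_map_fun_is_linear.

Lemma dual_map_funP : supergrading J_ -> supergrading V_ ->
  is_dual_map J_ V_ pi (linfun dual_map_fun).
Proof.
move=> sJ sV i j x f Jx Vf; rewrite lfunE /= dual_map_funE.
(* Homogeneity of [x] leaves only the outer index [i]; that of [f] will leave only the inner index
   [j]. *)
rewrite /twisted_action (bigD1 i) //= [X in _ + X]big1 ?addr0; last first.
  move=> k ki; apply: big1 => l _.
  by rewrite (homog_proj_neq sJ Jx ki) linear0 comp_lfun0r scaler0.
rewrite (homog_proj_id sJ Jx).
apply/lfunP=> v; rewrite comp_lfunE sum_lfunE linear_sum (bigD1 j) //=.
rewrite [X in _ + X]big1 ?addr0.
  rewrite !scale_lfunE linearZ /= !comp_lfunE; congr (_ *: _).
  by rewrite -comp_lfunE (dual_homog_comp_proj sV _ Vf) eqxx.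
move=> k kj; rewrite scale_lfunE linearZ /= comp_lfunE -comp_lfunE.
by rewrite (dual_homog_comp_proj sV _ Vf) (negPf kj) zero_lfunE scaler0.
Qed.

Lemma dual_map_unique pi1 pi2 : supergrading J_ -> supergrading V_ ->
  is_dual_map J_ V_ pi pi1 -> is_dual_map J_ V_ pi pi2 -> pi1 = pi2.
Proof.
move=> sJ sV d1 d2; apply: (homog_lfunP sJ) => i x Jx.
apply: (homog_lfunP (dual_supergrading sV)) => j f Vf.
by rewrite (d1 i j) ?(d2 i j).
Qed.

(** As [2i = 0], [g] sends [V_ (i + j + 1)] into [V_ (j + 1)], where [f] vanishes. *)
Lemma dual_homog_comp i j (g : 'End(V)) (f : 'Hom(V, K^o)) :
  end_homogeneous V_ i g -> f \in dual_homog V_ j ->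
  (f \o g)%VF \in dual_homog V_ (i + j).
Proof.
move=> gi /memv_dual_homog f0; apply/memv_dual_homog=> v Vv.
rewrite comp_lfunE f0 // (_ : j + 1 = i + (i + j + 1)) ?gi //.
by case: i j {gi f0 Vv} => [[|[|//]] ilt] [[|[|//]] jlt]; apply: val_inj.
Qed.

Lemma dual_map_representation (m : {bilinear J -> J -> J}) pi' :
  mock_lie_superalgebra J_ m -> mls_representation J_ m V_ pi ->
  is_dual_map J_ V_ pi pi' -> mls_representation J_ m (dual_homog V_) pi'.
Proof.
move=> HJ [sV ev mul] d; have sD := dual_supergrading sV; split=> //.
  move=> i x Jx j f Vf; rewrite (d i j) //.
  by rewrite memvZ // dual_homog_comp //; apply: ev.
move=> i j x y Jx Jy; apply: (homog_lfunP sD) => k f Vf.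
rewrite (d (i + j) k) //; last exact: (mls_even HJ).
rewrite (mul i j) // add_lfunE !opp_lfunE scale_lfunE !comp_lfunE.
rewrite (d j k y f) // (d i k x f) // !linearZ /=.
(* The outer sign involves the degree of the inner form, already shifted by the first action. *)
rewrite (d i (j + k) x) //; last by apply: dual_homog_comp => //; apply: ev.
rewrite (d j (i + k) y) //; last by apply: dual_homog_comp => //; apply: ev.
rewrite comp_lfunDr -comp_lfunZr !comp_lfunNr !comp_lfunA.
set A := (f \o pi x \o pi y)%VF; set B := (f \o pi y \o pi x)%VF.
(* Composition order is reversed, so [A] comes from the second summand on the right; swapping the
   summands aligns the two sides. *)
rewrite scalerDr !scalerN !scalerA [RHS]addrC.
congr (- (_ *: _) - _ *: _).
(* Degrees such as [j + k] are reduced modulo 2 inside the exponents, so both sign identities are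
   checked on the eight triples of degrees. *)
all: by case: i j k {Jx Jy Vf A B} => [[|[|//]] ?] [[|[|//]] ?] [[|[|//]] ?];
  rewrite /= ?expr0 ?expr1 ?mulrNN ?mulr1 ?mul1r ?mulrNN ?mulr1.
Qed.

End DualMap.

Theorem proposition2p7 (K : fieldType) (char0 : [pchar K] =i pred0)
    (J : vectType K) (J_ : 'Z_2 -> {vspace J}) (m : {bilinear J -> J -> J})
    (HJ : mock_lie_superalgebra J_ m)
    (V : vectType K) (V_ : 'Z_2 -> {vspace V}) (pi : 'Hom(J, 'End(V)))
    (Hpi : mls_representation J_ m V_ pi) :
  (exists! pi' : 'Hom(J, 'End('Hom(V, K^o))), is_dual_map J_ V_ pi pi') /\
  (forall pi' : 'Hom(J, 'End('Hom(V, K^o))),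
     is_dual_map J_ V_ pi pi' ->
     mls_representation J_ m (dual_homog V_) pi').
Proof.
have sJ := mls_grading HJ; have sV := rep_grading Hpi; split; last first.
  by move=> pi'; apply: dual_map_representation.
exists (linfun (dual_map_fun J_ V_ pi)).
split=> [|pi' d]; first exact: dual_map_funP.
by apply: (dual_map_unique sJ sV _ d); apply: dual_map_funP.
Qed.
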